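(* Let $\alpha,\beta\in\mathbb{R}$ with $|\alpha|\neq|\beta|$. If $p\in\mathbb{N}$ is even, then the improper integral $$\mathcal{I}_{p,1}(\alpha,\beta)=\int_0^\infty\frac{(\cos\alpha x-\cos\beta x)^p}{x}\,dx$$ diverges.
   Context: $\mathbb{N}=\{1,2,3,\ldots\}$. The integral is an improper (Riemann) integral at both endpoints: it converges (exists) if $\int_\varepsilon^R$ of the integrand tends to a finite limit as $\varepsilon\to0^+$ and $R\to\infty$ independently, and it diverges otherwise. *)

(* Defs.v *)
From Stdlib Require Import Reals.
From Coquelicot Require Import Coquelicot.
Open Scope R_scope.

(* The finite limit of [RInt f a b] as a -> 0+ and b -> +oo independently:
   [ex_RInt_gen] takes the limit along the product of the two filters. *)
Definition improper_integral_converges (f : R -> R) : Prop :=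
  ex_RInt_gen f (at_right 0) (Rbar_locally p_infty).

Definition improper_integral_diverges (f : R -> R) : Prop :=
  ~ improper_integral_converges f.

(* Main.v *)
Require Import Defs.
From Stdlib Require Import Reals.
From Coquelicot Require Import Coquelicot.
From Stdlib Require Import Lra.
Open Scope R_scope.

(** Write [p = 2 k] and [y = (cos (alpha x) - cos (beta x)) ^ 2 >= 0].  The
    linearisation of [y] is [1] plus a sum of cosines,
      [y - 1 = cos (2 alpha x) / 2 + cos (2 beta x) / 2
               - cos ((alpha + beta) x) - cos ((alpha - beta) x)],
    and the last two frequencies are nonzero because [|alpha| <> |beta|].
    Bernoulli's inequality [y ^ k >= 1 + k (y - 1)] therefore bounds the
    integrand below by [1 / x] plus terms [c cos (omega x) / x] in which
    [omega = 0] occurs only with [c >= 0].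

    The integral of [1 / x] diverges at infinity, while each cosine term
    contributes an amount bounded below, by one integration by parts when
    [omega <> 0].  To avoid manipulating integrals of the separate terms, the
    argument is run on sub-primitives, that is, functions whose derivative is
    at most the given function: each [c cos (omega x) / x] has a nonnegative
    one ([nonneg_subprimitive_cos]), so the integrand has one that is at least
    [ln], and this forces divergence
    ([subprimitive_to_infinity_diverges]). *)

(** Sub-primitives rather than primitives, because the primitive of
    [cos (omega x) / x] is not elementary; nonnegativity is the
    boundedness from below, normalised so that it survives sums. *)
Definition has_nonneg_subprimitive (h : R -> R) : Prop :=
  exists G : R -> R, forall x, 0 < x ->
    0 <= G x /\ exists d, is_derive G x d /\ d <= h x.

Lemma nonneg_subprimitive_plus (h1 h2 : R -> R) :
  has_nonneg_subprimitive h1 -> has_nonneg_subprimitive h2 ->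
  has_nonneg_subprimitive (fun x => h1 x + h2 x).
Proof.
  intros [G1 H1] [G2 H2].
  exists (fun x => G1 x + G2 x); intros x Hx.
  destruct (H1 x Hx) as [P1 [d1 [D1 L1]]].
  destruct (H2 x Hx) as [P2 [d2 [D2 L2]]].
  split; [lra|].
  exists (d1 + d2); split; [|lra].
  now apply (is_derive_plus (V := R_NormedModule)).
Qed.

Lemma nonneg_subprimitive_scal (k : R) (h : R -> R) :
  0 <= k -> has_nonneg_subprimitive h ->
  has_nonneg_subprimitive (fun x => k * h x).
Proof.
  intros Hk [G H].
  exists (fun x => k * G x); intros x Hx.
  destruct (H x Hx) as [P [d [D L]]].
  split; [now apply Rmult_le_pos|].
  exists (k * d); split; [|now apply Rmult_le_compat_l].
  now apply is_derive_scal.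
Qed.

(** Integration by parts gives
    [c cos (omega x) / x = (e sin (omega x) / x)' + e sin (omega x) / x ^ 2]
    with [e = c / omega], and the remainder is at least
    [- |e| / x ^ 2 = (|e| / x)'].  Hence [(|e| + e sin (omega x)) / x] is a
    sub-primitive, and it is visibly nonnegative. *)
Lemma nonneg_subprimitive_cos (c omega : R) :
  (omega = 0 -> 0 <= c) ->
  has_nonneg_subprimitive (fun x => c * cos (omega * x) / x).
Proof.
  intros Hc.
  destruct (Req_dec omega 0) as [E|N].
  - exists (fun _ => 0); intros x Hx; split; [lra|].
    exists 0; split; [apply (is_derive_const (V := R_NormedModule))|].
    rewrite E, Rmult_0_l, cos_0, Rmult_1_r.
    apply Rdiv_le_0_compat; [now apply Hc|exact Hx].
  - set (e := c / omega).
    assert (S : forall t, - Rabs e <= e * sin t).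
    { intros t.
      assert (A : Rabs (e * sin t) <= Rabs e * 1).
      { rewrite Rabs_mult; apply Rmult_le_compat_l; [apply Rabs_pos|].
        apply Rabs_le, SIN_bound. }
      apply Rabs_le_between in A; lra. }
    exists (fun x => (Rabs e + e * sin (omega * x)) / x); intros x Hx.
    specialize (S (omega * x)).
    split; [apply Rdiv_le_0_compat; lra|].
    exists (c * cos (omega * x) / x
            - (Rabs e + e * sin (omega * x)) / x ^ 2); split.
    + auto_derive; [lra|].
      replace c with (e * omega) by (unfold e; field; exact N).
      field; lra.
    + assert (0 <= (Rabs e + e * sin (omega * x)) / x ^ 2); [|lra].
      apply Rdiv_le_0_compat; [lra|now apply pow_lt].
Qed.

(** With [F] the integral of [f] from a fixed [a > 0], the difference [F - G]
    is nondecreasing, so [F] tends to infinity along with [G]; but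
    convergence keeps [F] near a finite limit once [a] is small. *)
Lemma subprimitive_to_infinity_diverges (f G : R -> R) :
  (forall x, 0 < x -> continuous f x) ->
  (forall x, 0 < x -> exists d, is_derive G x d /\ d <= f x) ->
  is_lim G p_infty p_infty ->
  improper_integral_diverges f.
Proof.
  intros Hf HG Hlim [l Hl].
  destruct (Hl (ball l 1) (locally_ball l (mkposreal 1 Rlt_0_1)))
    as [Q T [eps HQ] [M HT] H].
  set (a := eps / 2).
  assert (Ha : 0 < a) by (unfold a; destruct eps; simpl; lra).
  assert (Qa : Q a).
  { apply HQ; [|exact Ha].
    change (Rabs (a - 0) < eps).
    rewrite Rminus_0_r, Rabs_pos_eq by lra.
    unfold a; destruct eps; simpl; lra. }
  apply is_lim_spec in Hlim.
  (* Monotonicity of [F - G] and [F a = 0] give [F b >= G b - G a], which this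
     threshold on [G b] pushes above [l + 1]. *)
  destruct (Hlim (l + 1 + G a)) as [N HN].
  set (b := Rmax a (Rmax M N) + 1).
  assert (Hb : a < b /\ M < b /\ N < b).
  { pose proof (Rmax_l a (Rmax M N)); pose proof (Rmax_r a (Rmax M N)).
    pose proof (Rmax_l M N); pose proof (Rmax_r M N).
    unfold b; lra. }
  destruct Hb as [Hab [HMb HNb]].
  destruct (H a b Qa (HT b HMb)) as [y [Iy By]]; simpl in Iy.
  apply (is_RInt_unique (V := R_CompleteNormedModule)) in Iy.
  assert (Int : forall x, 0 < x -> ex_RInt f a x).
  { intros x Hx; apply (ex_RInt_continuous (V := R_CompleteNormedModule)).
    intros z [Hz _]; apply Hf.
    apply Rlt_le_trans with (2 := Hz); now apply Rmin_glb_lt. }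
  assert (DF : forall x, 0 < x -> is_derive (RInt f a) x (f x)).
  { intros x Hx.
    apply (is_derive_RInt (V := R_NormedModule)) with a; [|now apply Hf].
    exists (mkposreal x Hx); intros z Hz.
    apply (RInt_correct (V := R_CompleteNormedModule)), Int.
    change (Rabs (z - x) < x) in Hz.
    apply Rabs_lt_between in Hz; lra. }
  set (D := fun x => RInt f a x - G x).
  assert (DD : forall x, 0 < x -> is_derive D x (Derive D x) /\ 0 <= Derive D x).
  { intros x Hx; destruct (HG x Hx) as [d [Hd Ld]].
    assert (E : is_derive D x (f x - d)).
    { apply (is_derive_minus (V := R_NormedModule)); [now apply DF|exact Hd]. }
    rewrite (is_derive_unique _ _ _ E); split; [exact E|lra]. }
  destruct (MVT_gen D a b (Derive D)) as [xi [Hxi E]].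
  { intros x [Hx _]; rewrite Rmin_left in Hx by lra; apply DD; lra. }
  { intros x [Hx _]; rewrite Rmin_left in Hx by lra.
    apply continuity_pt_filterlim, (ex_derive_continuous (V := R_NormedModule)).
    exists (Derive D x); apply DD; lra. }
  rewrite Rmin_left in Hxi by lra.
  assert (P : 0 <= D b - D a).
  { rewrite E; apply Rmult_le_pos; [apply DD|]; lra. }
  unfold D in P.
  rewrite (RInt_point (V := R_CompleteNormedModule)) in P.
  change (zero : R) with 0 in P.
  rewrite Iy in P.
  specialize (HN b HNb).
  change (Rabs (y - l) < 1) in By.
  apply Rabs_lt_between in By; lra.
Qed.

Lemma bernoulli_pow (y : R) (k : nat) : 0 <= y -> 1 + INR k * (y - 1) <= y ^ k.
Proof.
  intros Hy; induction k as [|k IH]; [simpl; lra|].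
  rewrite S_INR; simpl.
  apply Rle_trans with (y * (1 + INR k * (y - 1))).
  - pose proof (Rmult_le_pos _ _ (pos_INR k) (pow2_ge_0 (y - 1))); lra.
  - now apply Rmult_le_compat_l.
Qed.

Lemma cos_minus_cos_sqr (alpha beta x : R) :
  (cos (alpha * x) - cos (beta * x)) ^ 2 - 1 =
  1 / 2 * cos (2 * alpha * x) + 1 / 2 * cos (2 * beta * x)
  + -1 * cos ((alpha + beta) * x) + -1 * cos ((alpha - beta) * x).
Proof.
  rewrite !(Rmult_assoc 2), !cos_2a_cos.
  rewrite Rmult_plus_distr_r, Rmult_minus_distr_r, cos_plus, cos_minus.
  field.
Qed.

Theorem theorem3p1 (alpha beta : R) (p : nat)
  (hab : Rabs alpha <> Rabs beta) (hp : (1 <= p)%nat) (hpe : Nat.Even p) :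
  improper_integral_diverges
    (fun x : R => (cos (alpha * x) - cos (beta * x)) ^ p / x).
Proof.
  destruct hpe as [k ->].
  assert (Nplus : alpha + beta <> 0).
  { intros E; apply hab; replace alpha with (- beta) by lra; apply Rabs_Ropp. }
  assert (Nminus : alpha - beta <> 0).
  { intros E; apply hab; f_equal; lra. }
  assert (Hosc : has_nonneg_subprimitive (fun x => INR k *
    (1 / 2 * cos (2 * alpha * x) / x + 1 / 2 * cos (2 * beta * x) / x
     + -1 * cos ((alpha + beta) * x) / x
     + -1 * cos ((alpha - beta) * x) / x))).
  { apply nonneg_subprimitive_scal; [apply pos_INR|].
    repeat apply nonneg_subprimitive_plus;
      apply nonneg_subprimitive_cos; intros; lra. }
  destruct Hosc as [G HG].
  apply subprimitive_to_infinity_diverges with (G := fun x => ln x + G x).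
  - intros x Hx; apply (ex_derive_continuous (V := R_NormedModule)).
    auto_derive; lra.
  - intros x Hx; destruct (HG x Hx) as [_ [d [Hd Ld]]].
    exists (/ x + d); split.
    { apply (is_derive_plus (V := R_NormedModule)); [|exact Hd].
      now apply is_derive_ln. }
    rewrite pow_mult.
    pose proof (bernoulli_pow _ k
      (pow2_ge_0 (cos (alpha * x) - cos (beta * x)))) as B.
    rewrite cos_minus_cos_sqr in B.
    apply Rmult_le_compat_r with (r := / x) in B;
      [|now apply Rlt_le, Rinv_0_lt_compat].
    apply Rle_trans with (2 := B).
    unfold Rdiv in Ld |- *; lra.
  - apply is_lim_le_p_loc with ln; [|apply is_lim_ln_p].
    exists 0; intros x Hx; pose proof (proj1 (HG x Hx)); lra.
Qed.
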